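(* For every integer $n\ge 3$, the line graph $L(K_{2n})$ of the complete graph $K_{2n}$ is a vertex transitive graph whose core is isomorphic to $K_{2n-1}$, so that its core has $\frac{1}{n}|V(L(K_{2n}))|$ vertices, and there is no partition of $V(L(K_{2n}))$ into sets each of which induces a subgraph of $L(K_{2n})$ isomorphic to its core.
   Context: All graphs are finite, undirected and simple (no loops). A graph is vertex transitive if its automorphism group acts transitively on its vertex set. A homomorphism from a graph $X$ to a graph $Y$ is a map $\varphi:V(X)\to V(Y)$ such that $\varphi(x)$ is adjacent to $\varphi(y)$ whenever $x$ is adjacent to $y$. A core of a graph $X$ is a subgraph of $X$ with the minimum number of vertices among all subgraphs to which $X$ admits a homomorphism; all cores of $X$ are isomorphic, so one speaks of the core of $X$. The line graph $L(K_{2n})$ has as vertices the edges of $K_{2n}$, two distinct edges being adjacent if they share an endpoint. *)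

(* Defs.v *)
From HB Require Import structures.
From mathcomp Require Import all_boot all_order all_algebra all_fingroup.

Set Implicit Arguments.
Unset Strict Implicit.
Unset Printing Implicit Defensive.

Record sgraph := SGraph {
  vertex :> finType;
  adj : rel vertex;
  adj_sym : symmetric adj;
  adj_irrefl : irreflexive adj }.

Definition homomorphism (X Y : sgraph) (f : X -> Y) : Prop :=
  forall x y : X, adj x y -> adj (f x) (f y).

Definition admits_hom (X Y : sgraph) : Prop :=
  exists f : X -> Y, homomorphism f.

Definition isomorphic (X Y : sgraph) : Prop :=
  exists2 f : X -> Y, bijective f & forall x y : X, adj (f x) (f y) = adj x y.

Definition aut (X : sgraph) : {set {perm X}} :=
  [set s : {perm X} | [forall x, forall y, adj (s x) (s y) == adj x y]].

Lemma aut_group_set (X : sgraph) : group_set (aut X).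
Proof.
apply/group_setP; split=> [|s t].
  by rewrite inE; apply/forallP=> x; apply/forallP=> y; rewrite !perm1.
rewrite !inE => /forallP sP /forallP tP.
apply/forallP=> x; apply/forallP=> y; rewrite !permM.
by rewrite (eqP (forallP (tP _) _)) (eqP (forallP (sP _) _)).
Qed.

Canonical aut_group (X : sgraph) : {group {perm X}} := Group (aut_group_set X).

(* [transitive] also requires the vertex set to be nonempty. *)
Definition vertex_transitive (X : sgraph) : Prop :=
  [transitive aut X, on [set: X] | 'P].

(* Subgraphs need not be induced. *)
Record subgraph (X : sgraph) := Subgraph {
  sub_vertices : {set X};
  sub_adj : rel X;
  sub_adj_sym : symmetric sub_adj;
  sub_adjP : forall x y, sub_adj x y ->
    [&& x \in sub_vertices, y \in sub_vertices & adj x y] }.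

Section SubgraphAsGraph.
Variables (X : sgraph) (H : subgraph X).

Definition subgraph_vertex : finType := {x : X | x \in sub_vertices H}.
Definition subgraph_rel : rel subgraph_vertex := fun x y => sub_adj H (val x) (val y).

Lemma subgraph_adj_sym : symmetric subgraph_rel.
Proof. by move=> x y; apply: sub_adj_sym. Qed.

Lemma subgraph_adj_irrefl : irreflexive subgraph_rel.
Proof.
by move=> x; apply/negP=> /sub_adjP /and3P[_ _]; rewrite adj_irrefl.
Qed.

Definition graph_of_subgraph : sgraph :=
  SGraph subgraph_adj_sym subgraph_adj_irrefl.

End SubgraphAsGraph.

Coercion graph_of_subgraph : subgraph >-> sgraph.

Section Induced.
Variables (X : sgraph) (S : {set X}).

Definition induced_rel : rel X := fun x y => [&& x \in S, y \in S & adj x y].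

Lemma induced_adj_sym : symmetric induced_rel.
Proof. by move=> x y; rewrite /induced_rel adj_sym andbCA. Qed.

Lemma induced_adjP x y : induced_rel x y -> [&& x \in S, y \in S & adj x y].
Proof. by []. Qed.

Definition induced : subgraph X := Subgraph induced_adj_sym induced_adjP.

End Induced.

Definition is_core (X : sgraph) (C : subgraph X) : Prop :=
  admits_hom X C /\
  forall H : subgraph X, admits_hom X H -> #|{: C}| <= #|{: H}|.

Section Complete.
Variable m : nat.

Definition complete_rel : rel 'I_m := fun x y => x != y.

Lemma complete_adj_sym : symmetric complete_rel.
Proof. by move=> x y; rewrite /complete_rel eq_sym. Qed.

Lemma complete_adj_irrefl : irreflexive complete_rel.
Proof. by move=> x; rewrite /complete_rel eqxx. Qed.

Definition complete_graph : sgraph :=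
  SGraph complete_adj_sym complete_adj_irrefl.

End Complete.

Definition edges (X : sgraph) : {set {set X}} :=
  [set [set p.1; p.2] | p : X * X & adj p.1 p.2].

Section LineGraph.
Variable X : sgraph.

Definition line_vertex : finType := {a : {set X} | a \in edges X}.
Definition line_rel : rel line_vertex := fun a b => (a != b) && (val a :&: val b != set0).

Lemma line_adj_sym : symmetric line_rel.
Proof. by move=> a b; rewrite /line_rel eq_sym setIC. Qed.

Lemma line_adj_irrefl : irreflexive line_rel.
Proof. by move=> a; rewrite /line_rel eqxx. Qed.

Definition line_graph : sgraph := SGraph line_adj_sym line_adj_irrefl.

End LineGraph.

(* Main.v *)
Require Import Defs.
From HB Require Import structures.
From mathcomp Require Import all_boot all_order all_algebra all_fingroup.
From mathcomp Require Import zify.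

(** Put [m = 2n - 1].  The edges of K_(m+1) through a fixed vertex form a star,
    a clique of size [m] in the line graph ([card_star], [star_clique]).
    Since [m] is odd, K_(m+1) has a 1-factorization, i.e. a proper edge
    colouring with [m] colours ([edge_colouring]).  A graph that has both a
    clique of size [m] and a proper colouring with [m] colours has core K_m:
    it maps onto the clique, and every homomorphism is injective on the clique
    ([clique_is_core], [core_complete]).

    A cell of a partition into copies of the core would be a clique of size
    [m >= 5].  Pairwise intersecting pairs form a star or a triangle, so a clique
    with more than three elements lies in a star ([clique_sub_star]), and by
    cardinality each cell is a whole star.  One star does not cover all the
    edges, and the stars at [u] and [v] share the edge joining [u] to [v], so no
    collection of stars is a partition ([no_star_partition]).  Vertex transitivity
    holds because the symmetric group is transitive on pairs of vertices. *)

Set Implicit Arguments.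
Unset Strict Implicit.
Unset Printing Implicit Defensive.

(** * Cliques, colourings and cores *)

Definition clique (X : sgraph) (S : {set X}) : Prop :=
  {in S &, forall x y, x != y -> adj x y}.

Lemma hom_clique_inj (X Y : sgraph) (f : X -> Y) (S : {set X}) :
  homomorphism f -> clique S -> {in S &, injective f}.
Proof.
move=> homf clS x y xS yS fxy; apply/eqP/contraT => xy.
by have := homf _ _ (clS x y xS yS xy); rewrite fxy adj_irrefl.
Qed.

Lemma isomorphic_complete (X : sgraph) (k : nat) :
  #|X| = k -> (forall x y : X, x != y -> adj x y) ->
  isomorphic X (complete_graph k).
Proof.
move=> cX complX; exists (fun x => cast_ord cX (enum_rank x)).
  apply: inj_card_bij; last by rewrite card_ord cX.
  by move=> x y /cast_ord_inj/enum_rank_inj.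
move=> x y /=; rewrite /complete_rel (inj_eq (@cast_ord_inj _ _ cX)).
rewrite (inj_eq enum_rank_inj); case: eqVneq => [->|/complX //].
by rewrite adj_irrefl.
Qed.

Lemma card_subgraph (X : sgraph) (H : subgraph X) : #|H| = #|sub_vertices H|.
Proof. by rewrite card_sig; apply: eq_card. Qed.

Lemma clique_hom_card (X Y : sgraph) (S : {set X}) :
  clique S -> admits_hom X Y -> #|S| <= #|Y|.
Proof.
move=> clS [f homf]; rewrite -(card_in_imset (hom_clique_inj homf clS)).
exact: max_card.
Qed.

Section CliqueAndColouring.
Variables (X : sgraph) (k : nat) (S : {set X}).
Hypotheses (clS : clique S) (cardS : #|S| = k).
Hypothesis colX : admits_hom X (complete_graph k).

(** Using the elements of the clique as colours turns a colouring into a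
    homomorphism onto the clique. *)
Lemma admits_hom_clique : admits_hom X (induced S).
Proof.
case: colX => c homc.
have cS : k = #|S| by [].
pose g i : X := enum_val (cast_ord cS i).
have gS i : g i \in sub_vertices (induced S) by apply: enum_valP.
exists (fun x => Sub (g (c x)) (gS (c x)) : induced S) => x y /homc cxy.
rewrite /= /subgraph_rel /= /induced_rel !gS /=.
apply: clS; rewrite ?gS //.
by rewrite (inj_eq enum_val_inj) (inj_eq (@cast_ord_inj _ _ cS)).
Qed.

Lemma clique_is_core : is_core (induced S).
Proof.
split=> [|H homH]; first exact: admits_hom_clique.
by rewrite card_subgraph; apply: clique_hom_card homH.
Qed.

(** The image of the clique in a core is a clique with as many vertices as the
    core, so a core is complete even though subgraphs need not be induced. *)
Lemma core_complete (C : subgraph X) :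
  is_core C -> isomorphic C (complete_graph k).
Proof.
case=> [homC minC].
have cC : #|C| = k.
  apply/eqP; rewrite eqn_leq -{2}cardS (clique_hom_card clS homC) andbT.
  by rewrite -cardS -(card_subgraph (induced S)) minC //; apply: admits_hom_clique.
case: homC => f homf; apply: isomorphic_complete => // x y.
have onto : f @: S = [set: C].
  apply/eqP; rewrite eqEcard subsetT cardsT cC.
  by rewrite (card_in_imset (hom_clique_inj homf clS)) cardS leqnn.
have: x \in f @: S by rewrite onto.
have: y \in f @: S by rewrite onto.
move=> /imsetP[y' y'S ->] /imsetP[x' x'S ->] neq.
by apply: homf; apply: clS => //; apply: contraNneq neq => ->.
Qed.

End CliqueAndColouring.

Lemma isomorphic_clique (X : sgraph) (S : {set X}) (Y : sgraph) (k : nat) :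
  isomorphic (induced S) Y -> isomorphic Y (complete_graph k) ->
  clique S /\ #|S| = k.
Proof.
move=> [f bf fE] [g bg gE]; split=> [x y xS yS xy|].
  pose x' : induced S := Sub x xS; pose y' : induced S := Sub y yS.
  have: adj x' y'.
    rewrite -fE -gE /= /complete_rel (inj_eq (bij_inj bg)) (inj_eq (bij_inj bf)).
    by rewrite -val_eqE.
  by case/and3P.
by rewrite -(card_subgraph (induced S)) (bij_eq_card bf) (bij_eq_card bg) card_ord.
Qed.

(** * Edges and stars of a complete graph *)

Lemma edges_complete N (a : {set 'I_N}) :
  (a \in edges (complete_graph N)) = (#|a| == 2).
Proof.
apply/imsetP/cards2P => [[[x y]]|[x [y [xy ->]]]].
  by rewrite inE => xy ->; exists x, y.
by exists ((x, y) : complete_graph N * complete_graph N); rewrite ?inE.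
Qed.

Section LineGraphOfComplete.
Variable N : nat.
Local Notation L := (line_graph (complete_graph N)).

Lemma card_edge (e : L) : #|val e| = 2.
Proof. by apply/eqP; rewrite -edges_complete (valP e). Qed.

Lemma edgeE (e : L) (x y : 'I_N) :
  x != y -> x \in val e -> y \in val e -> val e = [set x; y].
Proof.
move=> xy xe ye; apply/esym/eqP; rewrite eqEcard card_edge cards2 xy andbT.
by rewrite subUset !sub1set xe.
Qed.

Lemma edge_endpoint (e : L) (x : 'I_N) :
  x \in val e -> exists2 y, x != y & val e = [set x; y].
Proof.
move=> xe; have [y /andP[ye xy]|none] := pickP [pred y | (y \in val e) && (x != y)].
  by exists y => //; apply: edgeE.
have: val e \subset [set x].
  by apply/subsetP => y ye; have := none y; rewrite /= ye inE eq_sym => /negbFE.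
by move/subset_leq_card; rewrite cards1 card_edge.
Qed.

Lemma edge_exists (x y : 'I_N) : x != y -> exists e : L, val e = [set x; y].
Proof.
move=> xy; have xyE : [set x; y] \in edges (complete_graph N).
  by rewrite edges_complete cards2 xy.
by exists (Sub [set x; y] xyE).
Qed.

Lemma line_adjP (e f : L) :
  reflect (e != f /\ exists2 v, v \in val e & v \in val f) (adj e f).
Proof.
apply: (iffP andP) => -[ef]; split=> //.
  by case/set0Pn: b => v /setIP[]; exists v.
by case: b => v ve vf; apply/set0Pn; exists v; rewrite inE ve.
Qed.

Lemma card_line : #|L| = 'C(N, 2).
Proof.
rewrite card_sig -[in RHS](card_ord N) -card_draws; apply: eq_card => a.
by rewrite !inE edges_complete.
Qed.

Definition star (v : 'I_N) : {set L} := [set e : L | v \in val e].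

Lemma star_clique v : clique (star v).
Proof.
by move=> e f; rewrite !inE => ve vf ef; apply/line_adjP; split=> //; exists v.
Qed.

Lemma card_star v : #|star v| = N.-1.
Proof.
rewrite -(card_imset _ val_inj) -[N in RHS]card_ord -(cardsC1 v).
rewrite -[RHS](@card_in_imset _ _ (fun y => [set v; y])).
  apply: eq_card => a; apply/imsetP/imsetP => [[e]|[y]]; rewrite !inE => vx ->.
    by have [y vy ->] := edge_endpoint vx; exists y; rewrite // !inE eq_sym.
  have [|e ee] := @edge_exists v y; first by rewrite eq_sym.
  by exists e; rewrite // inE ee set21.
move=> y z; rewrite !inE => yv zv /setP/(_ y); rewrite !inE eqxx orbT (negPf yv).
by move/esym/eqP.
Qed.

(** Two edges [{v, a}] and [{v, b}] of the clique are fixed.  An edge of the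
    clique that avoids [v] has to be [{a, b}], and if it occurs, it forces every
    edge of the clique to lie inside the triangle on [v], [a], [b]. *)
Lemma clique_sub_star (S : {set L}) :
  clique S -> 3 < #|S| -> exists v, S \subset star v.
Proof.
move=> clS cardS.
have meet e f : e \in S -> f \in S -> exists2 w, w \in val e & w \in val f.
  move=> eS fS; have [->|ef] := eqVneq e f; last by case/line_adjP: (clS _ _ eS fS ef).
  have /card_gt0P[w wf] : 0 < #|val f| by rewrite card_edge.
  by exists w.
have /card_gt1P[e [f [eS fS ef]]] : 1 < #|S| by apply: leq_trans cardS.
have [v ve vf] := meet e f eS fS.
have [a va eE] := edge_endpoint ve; have [b vb fE] := edge_endpoint vf.
have ab : a != b.
  by apply: contraNneq ef => ab; apply/eqP/val_inj; rewrite eE fE ab.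
exists v; apply/contraT => /subsetPn[g gS]; rewrite inE => vg.
have opposite h : h \in S -> v \notin val h -> val h = [set a; b].
  move=> hS vh; apply: edgeE => //.
    have [w] := meet e h eS hS; rewrite eE !inE => /orP[]/eqP-> //.
    by rewrite (negPf vh).
  have [w] := meet f h fS hS; rewrite fE !inE => /orP[]/eqP-> //.
  by rewrite (negPf vh).
have gE := opposite g gS vg.
suff sub : S \subset [set e; f; g].
  have := leq_trans cardS (subset_leq_card sub); rewrite -setUA cardsU1 cards2.
  by case: (_ \notin _); case: (_ != _).
apply/subsetP => h hS; rewrite !inE -!val_eqE /=.
have [vh|vh] := boolP (v \in val h); last by rewrite gE (opposite h) ?eqxx ?orbT.
have [w wh] := meet h g hS gS; rewrite gE !inE => /orP[]/eqP wE; rewrite wE in wh.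
  by rewrite eE (edgeE va vh wh) eqxx.
by rewrite fE (edgeE vb vh wh) eqxx orbT.
Qed.

Lemma no_star_partition (P : {set {set L}}) :
  2 < N -> partition P [set: L] ->
  ~ (forall S, S \in P -> exists v, S = star v).
Proof.
move=> N3 /and3P[/eqP covP trivP _] starP.
have block (e : L) : exists2 v, star v \in P & v \in val e.
  have: e \in cover P by rewrite covP.
  case/bigcupP => S SP eS; have [v vE] := starP S SP.
  by exists v; [rewrite -vE | move: eS; rewrite vE inE].
have /card_gt2P[x [y [z [_ [xy yz zx]]]]] : 2 < #|'I_N| by rewrite card_ord.
have [e0 _] := edge_exists xy; have [u uP _] := block e0.
(* Two of three distinct vertices differ from [u], which gives an edge that
   the star at [u] misses. *)
have [f uf] : exists f : L, u \notin val f.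
  have [ux|ux] := eqVneq u x.
    have [f fE] := edge_exists yz; exists f; rewrite fE !inE ux.
    by rewrite (negPf xy) eq_sym (negPf zx).
  have [uy|uy] := eqVneq u y.
    have [f fE] := edge_exists zx; exists f; rewrite fE !inE uy.
    by rewrite (negPf yz) eq_sym (negPf xy).
  by have [f fE] := edge_exists xy; exists f; rewrite fE !inE (negPf ux).
have [v vP vf] := block f.
have uv : u != v by apply: contraNneq uf => ->.
have [g gE] := edge_exists uv.
have gu : g \in star u by rewrite inE gE set21.
have gv : g \in star v by rewrite inE gE set22.
have : f \in star v by rewrite inE.
by rewrite -(def_pblock trivP vP gv) (def_pblock trivP uP gu) inE (negPf uf).
Qed.

(** Permutations of the vertices act on the edges, and a product of two
    transpositions carries any edge to any other. *)
Lemma line_complete_transitive : 1 < N -> vertex_transitive L.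
Proof.
move=> N2.
have /card_gt1P[x [y [_ _ xy]]] : 1 < #|'I_N| by rewrite card_ord.
have [e eE] := edge_exists xy.
have liftE (s : {perm 'I_N}) (f : L) : s @: val f \in edges (complete_graph N).
  by rewrite edges_complete card_imset ?card_edge //; apply: perm_inj.
pose lift (s : {perm 'I_N}) (f : L) : L := Sub (s @: val f) (liftE s f).
have lift_inj s : injective (lift s).
  by move=> f g /(congr1 val)/= /imset_inj fg; apply/val_inj/fg; apply: perm_inj.
have lift_aut s : perm (@lift_inj s) \in Defs.aut L.
  rewrite inE; apply/forallP => f; apply/forallP => g; rewrite !permE /=.
  rewrite /line_rel (inj_eq (@lift_inj s)) /=.
  by rewrite -imsetI ?imset_eq0 // => ? ? _ _; apply: perm_inj.
apply/imsetP; exists e => //; apply/esym/setP => f; rewrite inE.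
have /cards2P[x' [y' [xy' fE]]] : #|val f| == 2 by rewrite card_edge.
pose t := tperm x x'; pose s := (t * tperm (t y) y')%g.
have sx : s x = x'.
  rewrite permM tpermL tpermD //; last by rewrite eq_sym.
  by rewrite -(tpermL x x') (inj_eq perm_inj) eq_sym.
have sy : s y = y' by rewrite permM tpermL.
apply/orbitP; exists (perm (@lift_inj s)); first exact: lift_aut.
rewrite /= /aperm permE; apply: val_inj.
by rewrite /= eE fE imsetU1 imset_set1 sx sy.
Qed.

End LineGraphOfComplete.

(** * The 1-factorization of a complete graph of even order *)

Lemma eqn_mod_small m a b : a < m -> b < m -> (a == b %[mod m]) = (a == b).
Proof. by move=> am bm; rewrite !modn_small. Qed.

Lemma eqn_mod_double m a b :
  odd m -> a < m -> b < m -> (a * 2 == b * 2 %[mod m]) = (a == b).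
Proof.
move=> om am bm; apply/eqP/eqP => [|-> //].
wlog: a b am bm / a <= b => [H|ab].
  by case/orP: (leq_total a b) => ? E; [|apply/esym]; apply: H.
move/eqP; rewrite eq_sym eqn_mod_dvd ?leq_mul2r ?ab ?orbT // -mulnBl.
rewrite Gauss_dvdl ?coprimen2 // => /dvdn_leq; lia.
Qed.

(** The vertex [m] plays the role of infinity: a pair of finite vertices gets
    the colour [x + y], and the pair of infinity and [x] gets [2 x], which is
    the one sum mod [m] that no pair of finite vertices through [x] attains. *)
Definition edge_colour m (a : {set 'I_m.+1}) : nat :=
  (\sum_(x in a) (if x < m then val x else 0)) * (ord_max \in a).+1.

Lemma edge_colour_infty m (y : 'I_m.+1) :
  y < m -> edge_colour [set ord_max; y] = y * 2.
Proof.
move=> ym; rewrite /edge_colour big_setU1 /=; last first.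
  by rewrite inE -val_eqE /= neq_ltn ym orbT.
by rewrite big_set1 ltnn ym !inE eqxx.
Qed.

Lemma edge_colour_fin m (x y : 'I_m.+1) :
  x < m -> y < m -> x != y -> edge_colour [set x; y] = x + y.
Proof.
move=> xm ym xy; rewrite /edge_colour big_setU1 ?inE //= big_set1 xm ym.
by rewrite -!val_eqE /= !(gtn_eqF xm, gtn_eqF ym) muln1.
Qed.

Lemma edge_colour_proper m (x y z : 'I_m.+1) :
  odd m -> x != y -> x != z ->
  edge_colour [set x; y] = edge_colour [set x; z] %[mod m] -> y = z.
Proof.
move=> om.
have finP (w : 'I_m.+1) : w = ord_max \/ w < m.
  have := ltn_ord w; rewrite ltnS leq_eqVlt => /orP[/eqP wm|]; last by right.
  by left; apply: val_inj.
case: (finP x) => [->|xm].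
  case: (finP y) => [->|ym]; first by rewrite eqxx.
  case: (finP z) => [->|zm]; first by rewrite eqxx.
  move=> _ _ /eqP; rewrite !edge_colour_infty // eqn_mod_double // => /eqP.
  exact: val_inj.
case: (finP y) => [->|ym]; case: (finP z) => [->|zm] // xy xz /eqP.
- rewrite setUC edge_colour_infty // edge_colour_fin // muln2 -addnn.
  by rewrite eqn_modDl eqn_mod_small // val_eqE (negPf xz).
- rewrite [[set x; ord_max]]setUC edge_colour_infty // edge_colour_fin // muln2 -addnn.
  by rewrite eqn_modDl eqn_mod_small // val_eqE eq_sym (negPf xy).
- rewrite !edge_colour_fin // eqn_modDl eqn_mod_small // => /eqP.
  exact: val_inj.
Qed.

Lemma edge_colouring m : odd m ->
  admits_hom (line_graph (complete_graph m.+1)) (complete_graph m).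
Proof.
move=> om; have m0 : 0 < m by case: m om.
exists (fun e => Ordinal (ltn_pmod (edge_colour (val e)) m0)) => e f.
case/line_adjP => ef [x xe xf]; apply: contraNneq ef => /(congr1 val)/=.
have [y xy eE] := edge_endpoint xe; have [z xz fE] := edge_endpoint xf.
rewrite eE fE => /(edge_colour_proper om xy xz) yz.
by apply/eqP/val_inj; rewrite eE fE yz.
Qed.

Theorem mainTheorem3 (n : nat) (hn : 3 <= n) :
  let L := line_graph (complete_graph (2 * n)) in
  [/\ vertex_transitive L,
      exists C : subgraph L, is_core C
    & forall C : subgraph L, is_core C ->
      [/\ isomorphic C (complete_graph (2 * n - 1)),
          (#|{: C}|%:R = n%:R^-1 * #|{: L}|%:R :> rat)%R
        & ~ exists P : {set {set L}},
              partition P [set: L] /\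
              forall S : {set L}, S \in P -> isomorphic (induced S) C]].
Proof.
have cL : #|line_graph (complete_graph (2 * n))| = n * (2 * n - 1).
  by rewrite card_line bin2 -mulnA mul2n doubleK subn1.
have [m [mE nE om m5]] : exists m, [/\ 2 * n - 1 = m, 2 * n = m.+1, odd m & 4 < m].
  by exists (2 * n - 1); split=> //; lia.
rewrite {}mE in cL *; rewrite {}nE in cL *; move=> L.
have clS := @star_clique m.+1 ord0; have cS := @card_star m.+1 ord0.
have col := edge_colouring om.
split=> [||C coreC].
- by apply: line_complete_transitive; lia.
- by exists (induced (star (@ord0 m))); apply: (clique_is_core clS cS col).
have isoC := core_complete clS cS col coreC.
split=> //.
  have [g bg _] := isoC.
  rewrite (bij_eq_card bg) card_ord cL GRing.natrM GRing.mulKf // Num.Theory.pnatr_eq0; lia.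
case=> P [partP isoP]; apply: (no_star_partition _ partP); first lia.
move=> S /isoP/isomorphic_clique/(_ isoC)[clqS cardS].
have [|v Sv] := clique_sub_star clqS; first by rewrite cardS; lia.
by exists v; apply/eqP; rewrite eqEcard Sv card_star cardS leqnn.
Qed.
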